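(* Let $T\ge 2$, and let $f\in\mathbb{C}^T$ be the signal $f_i=\langle\psi|\mathrm{e}^{-\mathrm{i}Hi\Delta}|\psi\rangle$, $i=0,\dots,T-1$, where $H\in\mathbb{C}^{d\times d}$ is Hermitian, $|\psi\rangle\in\mathbb{C}^d$ is a unit vector and $\Delta>0$. Suppose that all entries of $f$ are nonzero, that is, $f\in\mathcal{S}_1$. Define $\gamma:=\min_i|f_i|^2>0$, and let $\eta>0$ and $\delta\in(0,1)$. Suppose the elements of the $1$-band of $Z=ff^\dagger$ are estimated as follows: each diagonal element $Z_{ii}$ is estimated using $N_{\mathrm{diag}}$ repetitions of the diagonal measurement circuit; each of the real and imaginary parts of each first off-diagonal element $Z_{i,i+1}$ is estimated using $N_{\mathrm{off}}$ repetitions of the corresponding off-diagonal measurement circuit. If $$N_{\mathrm{diag}}\ge\frac{8T}{\gamma\eta^2}\log\!\Big(\frac{4T}{\delta}\Big),\qquad N_{\mathrm{off}}\ge\frac{32T(2T^3-3T^2+T)}{3\gamma\eta^4}\log\!\Big(\frac{8(T-1)}{\delta}\Big),$$ then with probability at least $1-\delta$ the block-by-block algebraic estimator (with bandwidth $K=1$) applied to these estimates produces $\widehat f$ satisfying $$\|\widehat f-f\|_2\le\eta .$$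
   Context: $\mathcal{S}_1$ is the set of vectors in $\mathbb{C}^T$ with no zero entry. Note $f_0=1$. Write $Z_{ij}=f_i\overline{f_j}$. Measurement model (all repetitions are independent). Diagonal circuit for $Z_{ii}$: each repetition returns ''success'' with probability $Z_{ii}=|f_i|^2$, and $\widehat Z_{ii}$ is the fraction of successes among $N_{\mathrm{diag}}$ repetitions. Off-diagonal circuit for $Z_{ij}$, $j=i+1$: each repetition of the real-part circuit returns the value $+1$ with probability $\tfrac14\big(|f_i|^2+|f_j|^2+2\operatorname{Re}Z_{ij}\big)$, the value $-1$ with probability $\tfrac14\big(|f_i|^2+|f_j|^2-2\operatorname{Re}Z_{ij}\big)$, and $0$ otherwise; $\widehat{\operatorname{Re}Z_{ij}}$ is the average of $N_{\mathrm{off}}$ such values (an unbiased estimator of $\operatorname{Re}Z_{ij}$). The imaginary-part circuit is the same with $\operatorname{Im}Z_{ij}$ in place of $\operatorname{Re}Z_{ij}$, giving $\widehat{\operatorname{Im}Z_{ij}}$. Set $\widehat Z_{ij}=\widehat{\operatorname{Re}Z_{ij}}+\mathrm{i}\,\widehat{\operatorname{Im}Z_{ij}}$. Block-by-block algebraic estimator with $K=1$: set $\widehat f_0=1$ (with $\widehat\theta_0=0$); for $i=1,\dots,T-1$ in order, set $|\widehat f_i|=\sqrt{|\widehat Z_{ii}|}$, $\widehat\theta_i=\widehat\theta_{i-1}-\arg(\widehat Z_{i-1,i})\pmod{2\pi}$ where $\widehat\theta_{i-1}=\arg(\widehat f_{i-1})$ is the phase assigned at the previous step, and $\widehat f_i=|\widehat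 f_i|\,\mathrm{e}^{\mathrm{i}\widehat\theta_i}$. *)

(* Defs.v *)
From HB Require Import structures.
From mathcomp Require Import all_boot all_order all_algebra.
From mathcomp Require Import all_classical all_reals all_analysis.
From mathcomp Require Import complex.

Set Implicit Arguments.
Unset Strict Implicit.
Unset Printing Implicit Defensive.

Import Order.TTheory GRing.Theory Num.Theory.
Import numFieldNormedType.Exports.

Local Open Scope classical_set_scope.
Local Open Scope ring_scope.
Local Open Scope complex_scope.
Local Open Scope sesquilinear_scope.

(* Limit of the exponential series in the (entrywise) topology of matrices. *)
Definition expmx (K : numFieldType) (d : nat) (A : 'M[K]_d) : 'M[K]_d :=
  lim (series (fun k : nat => (k`!)%:R^-1 *: A ^+ k) @ \oo).

Section Signal.
Variable R : realType.

Definition modulus (z : R[i]) : R := ComplexField.Normc.normc z.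

Definition norm2 (n : nat) (v : 'cV[R[i]]_n) : R :=
  Num.sqrt (\sum_(i < n) modulus (v i 0) ^+ 2).

(* The vector (f_0, ..., f_(T-1)) is represented throughout by a function
   f : nat -> R[i], of which only the values at indices below T matter. *)
Definition signal (d : nat) (H : 'M[R[i]]_d) (psi : 'cV[R[i]]_d) (Delta : R)
    (k : nat) : R[i] :=
  (psi^t* *m expmx (- ('i * (k%:R * Delta)%:C) *: H) *m psi) 0 0.

(* The initial value f_0 of the iterated minimum is itself one of the entries,
   so that for 0 < T this is the minimum over the i < T. *)
Definition min_sqr_modulus (T : nat) (f : nat -> R[i]) : R :=
  \big[Num.min/modulus (f 0%N) ^+ 2]_(i < T) modulus (f i) ^+ 2.

End Signal.

Section Measurements.
Context {R : realType} {disp : measure_display} {Omega : measurableType disp}.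
Variable P : probability Omega R.

Definition mutually_independent (I : finType) (X : I -> {RV P >-> R}) : Prop :=
  forall (J : {set I}) (B : I -> set R), (forall i, measurable (B i)) ->
  P (\bigcap_(i in [set` J]) X i @^-1` B i) =
  (\prod_(i in J) P (X i @^-1` B i))%E.

(* One repetition of the diagonal circuit; success is encoded by the value 1. *)
Definition diag_law (p : R) (X : {RV P >-> R}) : Prop :=
  (forall w, X w = 0 \/ X w = 1) /\ P [set w | X w = 1] = p%:E.

(* One repetition of an off-diagonal circuit, with a = |f_i|^2, b = |f_j|^2,
   and t the real or the imaginary part of Z_ij. *)
Definition offdiag_law (a b t : R) (X : {RV P >-> R}) : Prop :=
  [/\ forall w, [\/ X w = 1, X w = -1 | X w = 0],
      P [set w | X w = 1] = ((a + b + 2 * t) / 4)%:E &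
      P [set w | X w = -1] = ((a + b - 2 * t) / 4)%:E].

Section Runs.
Variables (T Ndiag Noff : nat).

(* Repetition m of the diagonal circuit for Z_ii is D i m; repetition m of the
   real-part (imaginary-part) circuit for Z_(i,i+1) is A i m (B i m). *)
Variables D A B : nat -> nat -> {RV P >-> R}.

Definition all_runs
    (r : 'I_T * 'I_Ndiag + ('I_T.-1 * 'I_Noff + 'I_T.-1 * 'I_Noff)) :
    {RV P >-> R} :=
  match r with
  | inl (i, m) => D i m
  | inr (inl (i, m)) => A i m
  | inr (inr (i, m)) => B i m
  end.

Record measurement_model (f : nat -> R[i]) : Prop := {
  diag_runs : forall i m, (i < T)%N -> (m < Ndiag)%N ->
    diag_law (modulus (f i) ^+ 2) (D i m);
  offdiag_Re_runs : forall i m, (i.+1 < T)%N -> (m < Noff)%N ->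
    offdiag_law (modulus (f i) ^+ 2) (modulus (f i.+1) ^+ 2)
      (complex.Re (f i * (f i.+1)^*)) (A i m);
  offdiag_Im_runs : forall i m, (i.+1 < T)%N -> (m < Noff)%N ->
    offdiag_law (modulus (f i) ^+ 2) (modulus (f i.+1) ^+ 2)
      (complex.Im (f i * (f i.+1)^*)) (B i m);
  independent_runs : mutually_independent all_runs
}.

Definition sample_mean (N : nat) (X : nat -> {RV P >-> R}) (w : Omega) : R :=
  (\sum_(m < N) X m w) / N%:R.

Definition Zdiag (w : Omega) (i : nat) : R := sample_mean Ndiag (D i) w.

(* Zoff w i estimates Z_(i,i+1). *)
Definition Zoff (w : Omega) (i : nat) : R[i] :=
  sample_mean Noff (A i) w +i* sample_mean Noff (B i) w.

End Runs.
End Measurements.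

Section Estimator.
Variable R : realType.

(* Principal argument, in ]-pi, pi], with the convention arg 0 = 0. *)
Definition arg (z : R[i]) : R :=
  if z == 0 then 0
  else if 0 <= complex.Im z then acos (complex.Re z / modulus z)
  else - acos (complex.Re z / modulus z).

(* The representative of x modulo 2 pi in ]-pi, pi]. *)
Definition mod2pi (x : R) : R :=
  x - 2 * pi * (Num.ceil ((x - pi) / (2 * pi)))%:~R.

Variables (zdiag : nat -> R) (zoff : nat -> R[i]).

Fixpoint phase_estimate (i : nat) : R :=
  if i is j.+1 then mod2pi (phase_estimate j - arg (zoff j)) else 0.

Definition block_estimator (i : nat) : R[i] :=
  if i is 0%N then 1
  else (Num.sqrt `|zdiag i|)%:C *
       (cos (phase_estimate i) +i* sin (phase_estimate i)).

End Estimator.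

(* Main.v *)
(**
  Writing f_i = |f_i| g_i with |g_i| = 1, one has
  |r E - s g|^2 = (r - s)^2 + r s |E - g|^2 for unit E, g, so amplitude and
  phase errors separate. The phases accumulate along
  g_(i+1) = g_i conj(Z_(i,i+1) / |Z_(i,i+1)|), so relative errors at most
  sqrt v on the Z_(i,i+1) yield |E_i - g_i|^2 <= 2 v i^2. Each half of eta^2
  pays for one kind of error, with v = eta^2 / (4 \sum_i i^2).

  Only one factor of 1/gamma is available for N_off, which a Hoeffding bound
  would not achieve: an off-diagonal repetition is nonzero with probability
  q = (|f_i|^2 + |f_(i+1)|^2) / 2 only, and a Bernstein bound with variance q
  controls the relative error because |f_i|^2 |f_(i+1)|^2 >= gamma q.

  Since the entries have modulus at most 1 (|f_i|^2 is a probability), the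
  bound is trivial when eta^2 >= 4 (T - 1); otherwise the requested deviations
  are small enough for the third-order term of the Bernstein exponent to be
  absorbed.
*)
Require Import Defs.
From HB Require Import structures.
From mathcomp Require Import all_boot all_order all_algebra.
From mathcomp Require Import all_classical all_reals all_analysis.
From mathcomp Require Import complex.
From mathcomp Require Import ring lra.

Import Order.TTheory GRing.Theory Num.Theory.
Import numFieldNormedType.Exports.

Local Open Scope classical_set_scope.
Local Open Scope ring_scope.
Local Open Scope complex_scope.

(** * Polynomial bounds on the exponential *)

Lemma le_at0_of_derive_ge0 (R : realType) (g dg : R -> R) (x : R) : 0 <= x ->
  (forall y : R, is_derive y 1 g (dg y)) ->
  (forall y, 0 <= y <= x -> 0 <= dg y) -> g 0 <= g x.
Proof.
move=> x0 dgE dg0.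
have cg : {within `[0, x], continuous g}.
  apply: continuous_subspaceT => y; apply: differentiable_continuous.
  by apply/derivable1_diffP; case: (dgE y).
have [c cx gE] := @MVT_segment R g dg 0 x x0 (fun y _ => dgE y) cg.
by rewrite -subr_ge0 gE subr0 mulr_ge0// dg0.
Qed.

(** Multiplying the polynomial by exp (-y) gives a function with derivative exp (-y) (y^2 / 4) (1 -
    y), nonnegative up to y = 1. The Taylor coefficient 1/6 would be too small; 1/4 leaves room for
    the whole tail of the series. *)
Lemma expR_le_cubic (R : realType) (x : R) : 0 <= x <= 1 ->
  expR x <= 1 + x + (x ^+ 2 / 2 + x ^+ 3 / 4).
Proof.
move=> /andP[x0 x1].
pose g (y : R) : R := (1 + y + (y ^+ 2 / 2 + y ^+ 3 / 4)) * expR (- y).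
have dg (y : R) : is_derive y 1 g (expR (- y) * (y ^+ 2 / 4 * (1 - y))).
  by apply: is_derive_eq; rewrite /GRing.scale /=; field.
have : g 0 <= g x.
  apply: (@le_at0_of_derive_ge0 _ _ _ _ x0 dg) => y /andP[y0 yx].
  rewrite !mulr_ge0 ?expR_ge0 ?sqr_ge0 ?invr_ge0//.
  by rewrite subr_ge0 (le_trans yx).
rewrite /g oppr0 expR0 !expr0n/= !mul0r !addr0 mulr1 expRN.
by rewrite ler_pdivlMr ?expR_gt0// mul1r.
Qed.

Lemma expRN_le_quadratic (R : realType) (x : R) : 0 <= x ->
  expR (- x) <= 1 - x + x ^+ 2 / 2.
Proof.
move=> x0.
pose g (y : R) : R := (1 - y + y ^+ 2 / 2) * expR y.
have dg (y : R) : is_derive y 1 g (expR y * (y ^+ 2 / 2)).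
  by apply: is_derive_eq; rewrite /GRing.scale /=; field.
have : g 0 <= g x.
  apply: (@le_at0_of_derive_ge0 _ _ _ _ x0 dg) => y _.
  by rewrite mulr_ge0 ?expR_ge0// divr_ge0 ?sqr_ge0.
rewrite /g expR0 !expr0n/= !mul0r subr0 !addr0 mulr1 expRN => h.
by rewrite -[_^-1]mul1r ler_pdivrMr ?expR_gt0.
Qed.

(** * Initial value of the signal *)

Lemma signal0 (R : realType) (d : nat) (H : 'M[R[i]]_d) (psi : 'cV[R[i]]_d)
    (Delta : R) : norm2 psi = 1 -> signal H psi Delta 0 = 1.
Proof.
move=> n1; rewrite /signal mul0r /expmx.
have -> : (- ('i * 0%:C)%C *: H) = 0 by rewrite rmorph0 mulr0 oppr0 scale0r.
(* The partial sum at index 0 is empty, so the series is constantly 1 only from index 1 on. *)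
have -> : limn (series (fun k => (k`!)%:R^-1 *: (0 : 'M[R[i]]_d) ^+ k)) = 1%:M.
  apply: lim_near_cst => //; exists 1%N => // -[//|n] _.
  rewrite /series /= big_nat_recl//= big1 ?addr0.
    by rewrite fact0 invr1 scale1r expr0.
  by move=> k _; rewrite exprS mul0r scaler0.
rewrite mulmx1 mxE.
have := congr1 (fun x : R => (x ^+ 2)%:C) n1.
rewrite sqr_sqrtr ?sumr_ge0// => [|i _]; last exact: sqr_ge0.
rewrite expr1n rmorph1 rmorph_sum => /= <-.
apply: eq_bigr => i _; rewrite !mxE.
rewrite mulrC -sqr_normc normc_def -rmorphXn/=; congr _%:C.
by rewrite /modulus; case: (psi i 0).
Qed.

(** * Polar form and distances between phases *)

Section ComplexGeometry.
Context {R : realType}.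
Implicit Types (z w : R[i]) (x y : R).

Definition cis x : R[i] := cos x +i* sin x.

Lemma modulus_sqr z : modulus z ^+ 2 = complex.Re z ^+ 2 + complex.Im z ^+ 2.
Proof. by case: z => a b; rewrite sqr_sqrtr ?addr_ge0 ?sqr_ge0. Qed.

Lemma modulus_ge0 z : 0 <= modulus z.
Proof. by case: z => a b; rewrite sqrtr_ge0. Qed.

Lemma modulus_gt0 z : z != 0 -> 0 < modulus z.
Proof.
move=> z0; rewrite lt_neqAle modulus_ge0 andbT eq_sym.
by apply: contra z0 => /eqP/ComplexField.Normc.eq0_normc ->.
Qed.

Lemma conj_realc x : Num.conj (x%:C : R[i]) = x%:C.
Proof. exact: conjc_real. Qed.

Lemma modulusM z w : modulus (z * w) = modulus z * modulus w.
Proof. exact: ComplexField.Normc.normcM. Qed.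

Lemma modulusN z : modulus (- z) = modulus z.
Proof. by case: z => a b; rewrite /modulus /= !sqrrN. Qed.

Lemma modulusD z w : modulus (z + w) <= modulus z + modulus w.
Proof.
rewrite -lecR rmorphD /=.
have mE (t : R[i]) : (modulus t)%:C = `|t| by rewrite normc_def; case: t.
by rewrite !mE ler_normD.
Qed.

Lemma modulus_conj z : modulus (Num.conj z) = modulus z.
Proof. by case: z => a b; rewrite /modulus /= sqrrN. Qed.

Lemma modulus_cis x : modulus (cis x) = 1.
Proof. by rewrite /modulus /= cos2Dsin2 sqrtr1. Qed.

Lemma cisD x y : cis (x + y) = cis x * cis y.
Proof. by rewrite /cis cosD sinD; congr (_ +i* _); rewrite addrC. Qed.

Lemma cisN x : cis (- x) = Num.conj (cis x).
Proof. by rewrite /cis cosN sinN. Qed.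

Lemma cis_2pin n : cis (2 * pi * n%:R) = 1.
Proof.
rewrite mulr_natr mulr_natl /cis -[X in cos X]add0r -[X in sin X]add0r.
by rewrite (periodicn (@cosD2pi R)) (periodicn (@sinD2pi R)) cos0 sin0.
Qed.

Lemma cis_2piz (n : int) : cis (2 * pi * n%:~R) = 1.
Proof.
case: n => n; first by rewrite cis_2pin.
by rewrite NegzE mulrNz mulrN cisN cis_2pin rmorph1.
Qed.

Lemma cis_mod2pi x : cis (mod2pi x) = cis x.
Proof. by rewrite /mod2pi cisD cisN cis_2piz rmorph1 mulr1. Qed.

(** [acos] fixes the angle up to sign: with c = Re z / |z|, the product |z| sqrt (1 - c^2) is |Im
    z|. The test on Im z in [arg] then restores the sign of the sine. *)
Lemma polar_arg z : z != 0 -> z = (modulus z)%:C * cis (arg z).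
Proof.
move=> z0; have m0 := modulus_gt0 _ z0.
have mE := modulus_sqr z.
pose c := complex.Re z / modulus z.
have zc : complex.Re z = modulus z * c by rewrite /c mulrCA divff ?mulr1// gt_eqF.
have c1 : c ^+ 2 <= 1.
  rewrite -(@ler_pM2l _ (modulus z ^+ 2)) ?exprn_gt0// mulr1 -exprMn -zc mE.
  by rewrite lerDl sqr_ge0.
have c11 : -1 <= c <= 1 by rewrite -ler_norml -sqrtr_sqr -sqrtr1 ler_wsqrtr.
have im : modulus z * Num.sqrt (1 - c ^+ 2) = `|complex.Im z|.
  rewrite -{1}(ger0_norm (modulus_ge0 z)) -sqrtr_sqr -sqrtrM ?sqr_ge0//.
  by rewrite mulrBr mulr1 -exprMn -zc mE addrC addKr sqrtr_sqr.
have cc : cos (acos c) = c by rewrite acosK// in_itv.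
rewrite /arg (negPf z0) -/c.
case: ifPn => [i0|]; last rewrite -ltNge => /ltW i0;
  apply/eqP; rewrite eq_complex /cis /= ?cosN ?sinN sin_acos// cc.
  by rewrite !mul0r subr0 addr0 -zc im ger0_norm// !eqxx.
by rewrite !mul0r subr0 addr0 mulrN -zc im ler0_norm// opprK !eqxx.
Qed.

Lemma modulus_cisB x y :
  modulus (cis x - cis y) ^+ 2 = 2 - 2 * (cos x * cos y + sin x * sin y).
Proof.
rewrite modulus_sqr /=; have := cos2Dsin2 x; have := cos2Dsin2 y; lra.
Qed.

Lemma modulus_polarB (r s x y : R) :
  modulus (r%:C * cis x - s%:C * cis y) ^+ 2 =
  (r - s) ^+ 2 + r * s * modulus (cis x - cis y) ^+ 2.
Proof.
rewrite modulus_cisB modulus_sqr /= !mul0r !subr0 !addr0.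
have cx : cos x ^+ 2 = 1 - sin x ^+ 2 := cos2sin2 x.
have cy : cos y ^+ 2 = 1 - sin y ^+ 2 := cos2sin2 y.
ring: cx cy.
Qed.

(** Since v < 1, the disc around z misses the origin and w has a polar form. With r = |z|, s = |w|
    and c the cosine of the angle between them, the hypothesis reads s^2 + (1 - v) r^2 <= 2 r s c.
    Its left side exceeds 2 (1 - v) r s by (1 - v) (r - s)^2 + v s^2, hence c >= 1 - v. *)
Lemma phase_perturbation z w (v : R) : z != 0 -> 0 <= v < 1 ->
  modulus (w - z) ^+ 2 <= v * modulus z ^+ 2 ->
  modulus (cis (arg w) - cis (arg z)) ^+ 2 <= 2 * v.
Proof.
move=> z0 /andP[v0 v1] H.
have w0 : w != 0.
  apply/eqP => w0; move: H; rewrite w0 sub0r modulusN.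
  by rewrite -ler_pdivrMr ?exprn_gt0 ?modulus_gt0// divff
    ?expf_neq0 ?gt_eqF ?modulus_gt0// leNgt v1.
have rz := modulus_gt0 _ z0; have rw := modulus_gt0 _ w0.
move: H; rewrite {1}(polar_arg _ z0) {1}(polar_arg _ w0) modulus_polarB.
rewrite modulus_cisB; move: (cos _ * _ + _) => c.
move: (modulus z) (modulus w) rz rw => r s rz rw H.
suff : (1 - v) * (r * s) <= c * (r * s).
  by rewrite ler_pM2r ?mulr_gt0//; lra.
have := sqr_ge0 (r - s); have := sqr_ge0 s; nra.
Qed.
End ComplexGeometry.

(** * Deterministic error of the block estimator *)

Section EstimatorError.
Context {R : realType}.
Variables (T : nat) (f : nat -> R[i]) (zd : nat -> R) (zo : nat -> R[i]).
Hypotheses (f0 : f 0%N = 1) (fn0 : forall i, (i < T)%N -> f i != 0).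
Hypotheses (f1 : forall i, (i < T)%N -> modulus (f i) <= 1).
Hypotheses (zd01 : forall i, (i < T)%N -> 0 <= zd i <= 1).

Lemma estimator_polar i : (0 < i)%N -> (i < T)%N ->
  modulus (block_estimator zd zo i - f i) ^+ 2 =
  (Num.sqrt (zd i) - modulus (f i)) ^+ 2 + Num.sqrt (zd i) * modulus (f i) *
    modulus (cis (phase_estimate zo i) - cis (arg (f i))) ^+ 2.
Proof.
case: i => // i _ iT; have /andP[z0 _] := zd01 _ iT.
by rewrite {1}(polar_arg _ (fn0 _ iT)) -modulus_polarB /= ger0_norm.
Qed.

(** Serves the case of large [eta]. The squared phase distance is at most 4, so the error is at most
    (r - s)^2 + 4 r s = (r + s)^2 <= 4. Entry 0 is exact, which makes the total 4 (T - 1) rather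
    than 4 T. *)
Lemma estimator_error_le4 i : (i < T)%N ->
  modulus (block_estimator zd zo i - f i) ^+ 2 <= 4 * (0 < i)%N%:R.
Proof.
case: i => [|i] iT; first by rewrite /= f0 subrr modulus_sqr /= !expr0n mulr0 addr0.
rewrite estimator_polar//.
have /andP[z0 z1] := zd01 _ iT.
have r0 := sqrtr_ge0 (zd i.+1).
have r1 : Num.sqrt (zd i.+1) <= 1 by rewrite -sqrtr1 ler_wsqrtr.
have s0 := modulus_ge0 (f i.+1); have s1 := f1 _ iT.
have : modulus (cis (phase_estimate zo i.+1) - cis (arg (f i.+1))) ^+ 2 <= 4.
  rewrite modulus_cisB -cosB.
  have := cos_geN1 (phase_estimate zo i.+1 - arg (f i.+1)); lra.
have := sqr_ge0 (modulus (cis (phase_estimate zo i.+1) - cis (arg (f i.+1)))).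
move: (modulus (_ - _) ^+ 2) => q q0 q4.
move: (Num.sqrt _) (modulus _) r0 r1 s0 s1 => r s r0 r1 s0 s1.
have rs0 : 0 <= r * s by rewrite mulr_ge0.
have : r * s * q <= r * s * 4 by rewrite ler_wpM2l.
have : (r + s) ^+ 2 <= 2 ^+ 2 by rewrite lerXn2r ?nnegrE//; lra.
by rewrite mulr1; lra.
Qed.

Variables (e v : R).
Hypotheses (v01 : 0 <= v < 1).
Hypothesis diag_close : forall i, (i < T)%N ->
  (zd i - modulus (f i) ^+ 2) ^+ 2 <= e * modulus (f i) ^+ 2.
Hypothesis offdiag_close : forall i, (i.+1 < T)%N ->
  modulus (zo i - f i * (f i.+1)^*) ^+ 2 <= v * modulus (f i * (f i.+1)^*) ^+ 2.

Lemma phase_error i : (i < T)%N ->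
  modulus (cis (phase_estimate zo i) - cis (arg (f i))) <= i%:R * Num.sqrt (2 * v).
Proof.
have v0 : 0 <= v by case/andP: v01.
elim: i => [|i IH] iT.
  rewrite mul0r f0 /arg oner_eq0 /= lexx /modulus /= expr1n expr0n addr0.
  by rewrite sqrtr1 divr1 acos1 subrr subrr expr0n addr0 sqrtr0.
have iT' : (i < T)%N by exact: ltnW.
have fi0 := fn0 _ iT'; have fj0 := fn0 _ iT.
pose Z := f i * (f i.+1)^*.
have Z0 : Z != 0 by rewrite mulf_neq0// fmorph_eq0.
(* The exact phases obey the recursion of the estimator, with the exact Z in place of its
   estimate. *)
have gE : cis (arg (f i.+1)) = cis (arg (f i)) * cis (- arg Z).
  have ZE : Z = (modulus Z)%:C * (cis (arg (f i)) * (cis (arg (f i.+1)))^*).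
    rewrite modulusM modulus_conj /Z {1}(polar_arg _ fi0) {1}(polar_arg _ fj0).
    by rewrite !rmorphM /= conj_realc mulrACA.
  have /mulfI cZ : (modulus Z)%:C != 0 by rewrite fmorph_eq0 gt_eqF ?modulus_gt0.
  have {ZE} /cZ ZE := etrans (esym (polar_arg _ Z0)) ZE.
  rewrite cisN ZE rmorphM /= conjCK -cisN mulrA -cisD subrr.
  by rewrite /cis cos0 sin0 mul1r.
rewrite [phase_estimate _ _]/= cis_mod2pi cisD gE.
set E := cis (phase_estimate zo i); set g := cis (arg (f i)).
(* Unit factors preserve the modulus, so the inherited error and the new one simply add up. *)
have -> : E * cis (- arg (zo i)) - g * cis (- arg Z) =
  (E - g) * cis (- arg (zo i)) + g * (cis (- arg (zo i)) - cis (- arg Z)).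
  by ring.
apply: (le_trans (modulusD _ _)).
rewrite !modulusM modulus_cis mulr1.
rewrite modulus_cis mul1r -natr1 mulrDl mul1r lerD ?IH//.
rewrite !cisN -rmorphB modulus_conj -(ger0_norm (modulus_ge0 _)) -sqrtr_sqr.
by rewrite ler_wsqrtr// phase_perturbation// offdiag_close.
Qed.

(** For the amplitudes r = sqrt (zd i) and s = |f_i|, one has (r - s)^2 s^2 <= (r^2 - s^2)^2 <= e
    s^2, and s^2 cancels. The phase part uses r s <= 1 and the square of [phase_error]. *)
Lemma estimator_error i : (i < T)%N ->
  modulus (block_estimator zd zo i - f i) ^+ 2 <= e + 2 * v * (i ^ 2)%:R.
Proof.
have v0 : 0 <= v by case/andP: v01.
move=> iT; have fp := modulus_gt0 _ (fn0 _ iT).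
have e0 : 0 <= e.
  rewrite -(@pmulr_lge0 _ (modulus (f i) ^+ 2)) ?exprn_gt0//.
  exact: le_trans (sqr_ge0 _) (diag_close _ iT).
case: i iT fp => [|i] iT fp.
  by rewrite /= f0 subrr modulus_sqr /= !expr0n mulr0 !addr0.
rewrite estimator_polar//.
have /andP[z0 z1] := zd01 _ iT.
apply: lerD.
  rewrite -(@ler_pM2r _ (modulus (f i.+1) ^+ 2)) ?exprn_gt0//.
  apply: le_trans (diag_close _ iT).
  rewrite -exprMn -{2}(sqr_sqrtr z0) subr_sqr !exprMn ler_wpM2l ?sqr_ge0//.
  by rewrite lerXn2r ?nnegrE ?addr_ge0 ?sqrtr_ge0 ?modulus_ge0// lerDr sqrtr_ge0.
have r1 : Num.sqrt (zd i.+1) * modulus (f i.+1) <= 1.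
  by rewrite mulr_ile1 ?sqrtr_ge0 ?modulus_ge0 ?f1// -sqrtr1 ler_wsqrtr.
apply: (@le_trans _ _ (modulus (cis (phase_estimate zo i.+1) - cis (arg (f i.+1))) ^+ 2)).
  by rewrite ler_piMl ?sqr_ge0.
rewrite natrX -{1}(@sqr_sqrtr _ (2 * v)) ?mulr_ge0// mulrC -exprMn.
rewrite lerXn2r ?nnegrE ?modulus_ge0 ?mulr_ge0 ?sqrtr_ge0//.
exact: phase_error.
Qed.
End EstimatorError.

(** * Union bound and Chernoff bound for finite-valued families *)

Lemma measure_le_sum_cover (d : measure_display) (T : measurableType d)
    (R : realType) (mu : {measure set T -> \bar R}) (I : finType) (A : set T)
    (F : I -> set T) :
  measurable A -> (forall i, measurable (F i)) -> A `<=` \bigcup_i F i ->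
  (mu A <= \sum_(i : I) mu (F i))%E.
Proof.
move=> mA mF AF.
have mU (s : seq I) : measurable (\big[setU/set0]_(i <- s) F i).
  exact: bigsetU_measurable.
have mus (s : seq I) : (mu (\big[setU/set0]_(i <- s) F i) <= \sum_(i <- s) mu (F i))%E.
  elim: s => [|i s IH]; first by rewrite !big_nil measure0.
  by rewrite !big_cons (le_trans (measureU2 _ _ _))// leeD2l.
apply: le_trans (mus _); apply: le_measure; rewrite ?inE//.
move=> w /AF [i _ Fw]; rewrite -bigcup_seq; exists i => //=.
by rewrite mem_index_enum.
Qed.

Section FiniteValuedFamilies.
Context {R : realType} {disp : measure_display} {Omega : measurableType disp}.
Variable P : probability Omega R.

(** The events B are transported along h, with [setT] outside its image. Injectivity makes this well
    defined and lets the product be reindexed. *)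
Lemma mutually_independent_comp (I J : finType) (h : I -> J)
    (X : J -> {RV P >-> R}) : injective h ->
  mutually_independent X -> mutually_independent (X \o h).
Proof.
move=> hinj indX S B mB.
pose B' j := if [pick i | h i == j] is Some i then B i else setT.
have B'h i : B' (h i) = B i.
  by rewrite /B'; case: pickP => [k /eqP/hinj->|/(_ i)/eqP].
have mB' j : measurable (B' j) by rewrite /B'; case: pickP.
have := indX [set h i | i in S]%SET B' mB'.
rewrite big_imset/= => [|i k _ _ /hinj//].
under eq_bigr => i _ do rewrite B'h.
move=> <-; congr (P _); apply/seteqP; split => w /= H.
  by move=> j /= /imsetP[i iS ->]; rewrite B'h; exact: (H i).
by move=> i /= iS; rewrite -B'h; apply: (H (h i)); rewrite /= imset_f.
Qed.

Variables (I K : finType) (X : I -> {RV P >-> R}) (v : K -> R).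
Hypothesis Xv : forall i w, exists k, X i w = v k.

Let cylinder (s : {ffun I -> K}) : set Omega :=
  \bigcap_(i in [set` [set: I]%SET]) X i @^-1` [set v (s i)].

Let measurable_cylinder s : measurable (cylinder s).
Proof. exact: fin_bigcap_measurable. Qed.

Let cylinderP w : exists s, cylinder s w.
Proof.
have /choice[s sE] := Xv^~ w.
by exists (finfun s) => i _; rewrite /= ffunE.
Qed.

(** Such an event is a finite union of cylinders. Events about the estimator are thus measurable
    without any study of [arg] or [mod2pi]. *)
Lemma measurable_finite_valued (Q : set Omega) :
  (forall w w', (forall i, X i w = X i w') -> Q w -> Q w') -> measurable Q.
Proof.
move=> QX.
have -> : Q = \bigcup_(s in [set s | exists2 w, Q w & cylinder s w]) cylinder s.
  apply/seteqP; split=> [w Qw|w [s [w' Qw' sw'] sw]].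
    by have [s sw] := cylinderP w; exists s => //; exists w.
  by apply: QX Qw' => i; rewrite (sw i) ?(sw' i)/=.
by apply: fin_bigcup_measurable.
Qed.

(* The expectation of exp (l g X) never appears: the event is a finite union of
   cylinders, and the sum of their probabilities, weighted by
   exp (l (\sum_i g x_i - c)) >= 1, factors over the coordinates. *)
Lemma chernoff_finite_valued (g : R -> R) (l c : R) : mutually_independent X -> 0 <= l ->
  (P [set w | (c <= \sum_i g (X i w))%R] <=
   (expR (- (l * c)) * \prod_i \sum_k
      fine (P (X i @^-1` [set v k])) * expR (l * g (v k)))%:E)%E.
Proof.
move=> indX l0.
pose F (s : {ffun I -> K}) := if c <= \sum_i g (v (s i)) then cylinder s else set0.
have mF s : measurable (F s) by rewrite /F; case: ifP.
have mA : measurable [set w | c <= \sum_i g (X i w)].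
  apply: measurable_finite_valued => w w' ww' /=.
  by under eq_bigr do rewrite ww'.
apply: le_trans (measure_le_sum_cover _ _ _ P _ _ _ mA mF _) _.
  move=> w /= cw; have [s sw] := cylinderP w; exists s => //.
  rewrite /F; suff -> : \sum_i g (v (s i)) = \sum_i g (X i w) by rewrite cw.
  by apply: eq_bigr => i _; rewrite (sw i _)//= inE.
rewrite (bigA_distr_bigA (fun i k => fine (P (X i @^-1` [set v k])) * expR (l * g (v k))))/=
  mulr_sumr -sumEFin; apply: lee_sum => s _.
rewrite /F; case: ifPn => cs; last first.
  rewrite measure0 lee_fin mulr_ge0 ?expR_ge0// prodr_ge0// => i _.
  by rewrite mulr_ge0 ?expR_ge0 ?fine_ge0.
rewrite /cylinder (indX _ (fun i => [set v (s i)]))//.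
rewrite big_mkcond/=.
under eq_bigr => i _.
  rewrite inE -[P _]fineK; last by apply: fin_num_measure; exact: measurable_funPTI.
  over.
rewrite prodEFin lee_fin big_split/= mulrCA -expR_sum -expRD.
rewrite ler_peMr ?prodr_ge0// => [i _|]; first exact: fine_ge0.
rewrite -expR0 ler_expR -mulr_sumr -mulrN -mulrDr mulr_ge0// addrC subr_ge0//.
Qed.
End FiniteValuedFamilies.

(** * Bernstein bound for variables with values -1, 0 and 1 *)

Section TernaryTail.
Context {R : realType} {disp : measure_display} {Omega : measurableType disp}.
Variable P : probability Omega R.

Definition ternary (x : R) : Prop := [\/ x = 1, x = -1 | x = 0].

Definition ternary_value (k : 'I_3) : R := k%:R - 1.

Lemma ternary_valueP (x : R) : ternary x -> exists k, x = ternary_value k.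
Proof.
rewrite /ternary_value; case=> ->.
- by exists (inord 2); rewrite inordK//; lra.
- by exists (inord 0); rewrite inordK// sub0r.
- by exists (inord 1); rewrite inordK// subrr.
Qed.

(** [Q] bounds the second moment pp + pm, the probability of a nonzero outcome; this makes the bound
    of Bernstein type. The sign [sg] covers both tails. *)
Lemma ternary_mgf (X : {RV P >-> R}) (pp pm l Q : R) (sg : bool) :
  (forall w, ternary (X w)) ->
  P [set w | X w = 1] = pp%:E -> P [set w | X w = -1] = pm%:E ->
  pp + pm <= Q -> 0 <= l <= 1 ->
  \sum_k fine (P (X @^-1` [set ternary_value k])) *
    expR (l * ((-1) ^+ sg * ternary_value k)) <=
  expR (l * ((-1) ^+ sg * (pp - pm)) + Q * (l ^+ 2 / 2 + l ^+ 3 / 4)).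
Proof.
move=> X3 Xp Xm pQ /andP[l0 l1].
have mX (x : R) : measurable (X @^-1` [set x]) by exact: measurable_funPTI.
have mP (x : R) : P (X @^-1` [set x]) \is a fin_num by exact: fin_num_measure.
have Xp' : P (X @^-1` [set 1]) = pp%:E := Xp.
have Xm' : P (X @^-1` [set -1]) = pm%:E := Xm.
(* The mass at 0 is what remains of the total mass 1. *)
have p0 : fine (P (X @^-1` [set 0])) = 1 - pp - pm.
  have XT : [set: Omega] =
      X @^-1` [set 0] `|` (X @^-1` [set 1] `|` X @^-1` [set -1]).
    apply/seteqP; split=> // w _.
    by case: (X3 w) => /= ->; [right; left|right; right|left].
  pose p x := P (X @^-1` [set x]).
  have : (P setT = p 0%R + (p 1%R + p (- 1)%R))%E.
    have n10 : (1 : R) <> 0 by apply/eqP; rewrite oner_eq0.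
    have n11 : (1 : R) <> - 1 by move=> h; have : (1 : R) = 0 by lra.
    have n01 : (0 : R) <> - 1 by move=> h; apply: n10; lra.
    rewrite /p XT measureU//; last 2 first.
    - exact: measurableU.
    - by apply/seteqP; split=> // w /= [-> [/esym|]].
    by rewrite measureU//; apply/seteqP; split=> // w /= [->].
  rewrite probability_setT /p Xp' Xm' -(fineK (mP 0)) => -[] ->.
  by rewrite /=; lra.
have pp0 : 0 <= pp by rewrite -lee_fin -Xp.
have pm0 : 0 <= pm by rewrite -lee_fin -Xm.
rewrite /ternary_value !big_ord_recl big_ord0 addr0 /bump /=.
have -> : 0%:R - 1 = -1 :> R by rewrite sub0r.
have -> : 1%:R - 1 = 0 :> R by rewrite subrr.
have -> : 2%:R - 1 = 1 :> R by lra.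
rewrite p0 Xp' Xm' /= !mulr0 expR0.
have B0 : 0 <= l ^+ 2 / 2 + l ^+ 3 / 4 by rewrite addr_ge0// divr_ge0// exprn_ge0.
(* The bound for exp (-l) is weakened by l^3 / 4 so that both exponentials share one remainder,
   whose total weight is pp + pm. *)
have eN : expR (- l) <= 1 - l + (l ^+ 2 / 2 + l ^+ 3 / 4).
  apply: (le_trans (expRN_le_quadratic _ _ l0)).
  by rewrite addrA lerDl divr_ge0// exprn_ge0.
have eP := expR_le_cubic _ l (introT andP (conj l0 l1)).
apply: le_trans (expR_ge1Dx _).
move: (l ^+ 2 / 2 + l ^+ 3 / 4) B0 eN eP => B B0 eN eP.
have QB : (pp + pm) * B <= Q * B by rewrite ler_wpM2r.
case: sg; rewrite ?expr1 ?expr0 ?mulrN1 ?mulN1r ?opprK ?mul1r ?mulrN ?mulr1.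

  have := ler_wpM2l pp0 eN; have := ler_wpM2l pm0 eP; lra.
have := ler_wpM2l pp0 eP; have := ler_wpM2l pm0 eN; lra.
Qed.

Lemma sample_mean_tail (N : nat) (X : nat -> {RV P >-> R}) (pp pm l Q t : R) :
  (0 < N)%N -> mutually_independent (fun m : 'I_N => X m) ->
  (forall m w, (m < N)%N -> ternary (X m w)) ->
  (forall m, (m < N)%N -> P [set w | X m w = 1] = pp%:E) ->
  (forall m, (m < N)%N -> P [set w | X m w = -1] = pm%:E) ->
  pp + pm <= Q -> 0 <= l <= 1 ->
  (P [set w | (t <= `|sample_mean N X w - (pp - pm)|)%R] <=
   (2 * expR (- (N%:R * (l * t - Q * (l ^+ 2 / 2 + l ^+ 3 / 4)))))%:E)%E.
Proof.
move=> N0 indX X3 Xp Xm pQ l01; have /andP[l0 l1] := l01.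
have Xv (m : 'I_N) w : exists k, X m w = ternary_value k.
  by apply: ternary_valueP; exact: X3.
(* The upper deviation is [S false] and the lower one is [S true]; together they give the factor
   2. *)
pose S (sg : bool) := [set w | (N%:R * ((-1) ^+ sg * (pp - pm) + t) <=
  \sum_(m < N) (-1) ^+ sg * X m w)%R].
have mS sg : measurable (S sg).
  apply: (measurable_finite_valued P _ _ _ _ Xv) => w w' ww'.
  by rewrite /S /=; under eq_bigr do rewrite ww'.
have PS sg : (P (S sg) <=
    (expR (- (N%:R * (l * t - Q * (l ^+ 2 / 2 + l ^+ 3 / 4)))))%:E)%E.
  apply: (le_trans (chernoff_finite_valued P _ _ _ _ Xv (fun x => (-1) ^+ sg * x)
    _ _ indX l0)).
  rewrite lee_fin.
  apply: (@le_trans _ _ (expR (- (l * (N%:R * ((-1) ^+ sg * (pp - pm) + t)))) *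
     \prod_(m < N) expR (l * ((-1) ^+ sg * (pp - pm)) +
       Q * (l ^+ 2 / 2 + l ^+ 3 / 4)))).
    rewrite ler_wpM2l ?expR_ge0//; apply: ler_prod => m _.
    rewrite sumr_ge0 => [|k _]; last by rewrite mulr_ge0 ?expR_ge0 ?fine_ge0.
    apply: ternary_mgf => //; first by move=> w; exact: X3.
      exact: Xp.
    exact: Xm.
  rewrite prodr_const card_ord -expRM_natl -expRD ler_expR.
  by rewrite le_eqVlt; apply/predU1P; left; ring.
have mA : measurable [set w | (t <= `|sample_mean N X w - (pp - pm)|)%R].
  apply: (measurable_finite_valued P _ _ _ _ Xv) => w w' ww' /=.
  by rewrite /sample_mean; under eq_bigr do rewrite ww'.
apply: (le_trans (measure_le_sum_cover _ _ _ P bool _ S mA mS _)).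
  have N0' : 0 < N%:R :> R by rewrite ltr0n.
  move=> w /=; rewrite /sample_mean; set s := \sum_(m < N) X m w => ht.
  have sE : s = N%:R * (s / N%:R) by rewrite mulrC divfK// gt_eqF.
  have [h|h] := ltP (s / N%:R - (pp - pm)) 0.
    exists true => //; rewrite /S /= -mulr_sumr -/s expr1 !mulN1r sE -mulrN.
    by move: ht; rewrite ltr0_norm// ler_pM2l//; lra.
  exists false => //; rewrite /S /= -mulr_sumr -/s expr0 !mul1r sE.
  by move: ht; rewrite ger0_norm// ler_pM2l//; lra.
rewrite big_bool/= mulrDl mul1r EFinD; apply: leeD; exact: PS.
Qed.
End TernaryTail.

(** * Arithmetic of the sample sizes *)

(** Origin of the polynomial in the bound on [Noff]: the squared phase errors grow like i^2. *)
Lemma sum_sqr_ord (R : realFieldType) (n : nat) :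
  6 * \sum_(i < n) (i ^ 2)%:R = 2 * n%:R ^+ 3 - 3 * n%:R ^+ 2 + n%:R :> R.
Proof.
elim: n => [|n IH]; first by rewrite big_ord0 !expr0n !mulr0 subr0 addr0.
by rewrite big_ord_recr/= mulrDr IH natrX -natr1; ring.
Qed.

(** The Bernstein parameter is l = eps / 2 with Q = 1. As eps <= 2, the exponent per repetition is
    at least eps^2 / 4, and 8 T / (gamma eta^2) equals 4 / eps^2. *)
Lemma diag_sample_size (R : realType) (T n gamma eta L eps : R) :
  2 <= T -> 0 < gamma <= 1 -> 0 < eta -> eta ^+ 2 < 4 * (T - 1) ->
  0 <= eps -> eps ^+ 2 = gamma * eta ^+ 2 / (2 * T) -> 0 <= n ->
  8 * T / (gamma * eta ^+ 2) * L <= n ->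
  0 <= eps / 2 <= 1 /\
  L <= n * (eps / 2 * eps - 1 * ((eps / 2) ^+ 2 / 2 + (eps / 2) ^+ 3 / 4)).
Proof.
move=> T2 /andP[g0 g1] eta0 etaT eps0 epsE n0 nL.
have ge0 : 0 < gamma * eta ^+ 2 by rewrite mulr_gt0 ?exprn_gt0.
have eps2 : eps <= 2.
  rewrite -(@ler_pXn2r _ 2) ?nnegrE// epsE ler_pdivrMr; last by lra.
  have : gamma * eta ^+ 2 <= 1 * eta ^+ 2 by rewrite ler_wpM2r ?sqr_ge0.
  lra.
split; first by apply/andP; split; lra.
have nL' : L <= n * (eps ^+ 2 / 4).
  have T0 : 0 < 8 * T by lra.
  rewrite -(@ler_pM2l _ (8 * T / (gamma * eta ^+ 2))) ?divr_gt0//.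
  apply: le_trans nL _.
  by rewrite epsE le_eqVlt; apply/predU1P; left; field; rewrite !gt_eqF//; lra.
apply: (le_trans nL'); rewrite ler_wpM2l//.
have : eps ^+ 2 * eps <= eps ^+ 2 * 2 by rewrite ler_wpM2l ?sqr_ge0.
have := sqr_ge0 eps; lra.
Qed.

(** The parameter x = tau Z / q maximizes l (tau Z) - q l^2 / 2 over l. With the cubic term the
    exponent becomes q x^2 (1 - x / 2) / 2, where q x^2 >= gamma eta^2 / (8 S) and (1 - x / 2) / 2
    >= eta^2 / (8 T). The product of these bounds explains eta^4 and the constant 32/3. *)
Lemma offdiag_sample_size (R : realType) (T S n gamma eta L tau a b Z : R) :
  2 <= T -> 6 * S = 2 * T ^+ 3 - 3 * T ^+ 2 + T ->
  0 < gamma -> gamma <= a -> gamma <= b -> 0 < Z -> Z ^+ 2 = a * b ->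
  0 < eta -> eta ^+ 2 < 4 * (T - 1) ->
  0 <= tau -> tau ^+ 2 = eta ^+ 2 / (8 * S) -> 0 <= n ->
  32 * T * (2 * T ^+ 3 - 3 * T ^+ 2 + T) / (3 * gamma * eta ^+ 4) * L <= n ->
  let q := (a + b) / 2 in let x := tau * Z / q in
  0 <= x <= 1 /\ L <= n * (x * (tau * Z) - q * (x ^+ 2 / 2 + x ^+ 3 / 4)).
Proof.
move=> T2 SE g0 ga gb Z0 ZE eta0 etaT tau0 tauE n0 nL q x.
have a0 : 0 < a := lt_le_trans g0 ga.
have b0 : 0 < b := lt_le_trans g0 gb.
have q0 : 0 < q by rewrite divr_gt0 ?addr_gt0.
have S0 : 0 < S.
  have : 0 < T * (T - 1) * (2 * T - 1) by rewrite !mulr_gt0//; lra.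
  by move: SE; lra.
(* With [x <= tau] this gives [1 - x / 2 >= (T - 1) / T >= eta^2 / (4 T)]. *)
have tauT : tau <= 2 / T.
  rewrite ler_pdivlMr; last by lra.
  rewrite -(@ler_pXn2r _ 2) ?nnegrE ?mulr_ge0//; last by lra.
  rewrite exprMn tauE mulrAC ler_pdivrMr; last by lra.
  have : eta ^+ 2 * T ^+ 2 <= 4 * (T - 1) * T ^+ 2 by rewrite ler_wpM2r ?sqr_ge0 ?ltW.
  move/le_trans; apply.
  have -> : 2 ^+ 2 * (8 * S) = 16 / 3 * (6 * S) by field.
  rewrite SE -subr_ge0.
  have -> : 16 / 3 * (2 * T ^+ 3 - 3 * T ^+ 2 + T) - 4 * (T - 1) * T ^+ 2 =
     4 / 3 * (T * (T - 1) * (5 * T - 4)) by field.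
  by rewrite !mulr_ge0//; lra.
have tau1 : tau <= 1.
  by apply: (le_trans tauT); rewrite ler_pdivrMr; lra.
(* Inequality between the geometric and the arithmetic mean of a and b. *)
have Zq : Z <= q.
  rewrite -(@ler_pXn2r _ 2) ?nnegrE ?(ltW Z0) ?(ltW q0)// ZE.
  have -> : q ^+ 2 = a * b + (a - b) ^+ 2 / 4 by rewrite /q; field.
  by rewrite lerDl divr_ge0 ?sqr_ge0.
have x0 : 0 <= x.
  by apply: divr_ge0; [apply: mulr_ge0 => //; exact: ltW|exact: ltW].
have xtau : x <= tau by rewrite /x ler_pdivrMr// ler_wpM2l.
have xq : tau * Z = q * x by rewrite /x mulrCA divff ?mulr1// gt_eqF.
split; first by rewrite x0 (le_trans xtau).
rewrite xq.
have -> : x * (q * x) - q * (x ^+ 2 / 2 + x ^+ 3 / 4) =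
  q * x ^+ 2 * ((1 - x / 2) / 2) by field.
have qx : eta ^+ 2 / (8 * S) * gamma <= q * x ^+ 2.
  have -> : q * x ^+ 2 = tau ^+ 2 * (a * b / q).
    by rewrite -ZE /x; field; rewrite gt_eqF.
  rewrite -tauE ler_wpM2l ?sqr_ge0// ler_pdivlMr//.
  (* Averaging a b >= gamma a and a b >= gamma b gives a b >= gamma q. *)
  have := ler_wpM2l (ltW a0) gb; have := ler_wpM2r (ltW b0) ga; rewrite /q; lra.
have xT : eta ^+ 2 / (8 * T) <= (1 - x / 2) / 2.
  rewrite ler_pdivrMr; last by lra.
  have : tau * T <= 2 by move: tauT; rewrite ler_pdivlMr//; lra.
  have : x * T <= tau * T by rewrite ler_wpM2r//; lra.
  lra.
have e4 : 0 < gamma * eta ^+ 4 by rewrite mulr_gt0 ?exprn_gt0.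
have T0 : 0 < T by lra.
apply: (@le_trans _ _ (n * (eta ^+ 2 / (8 * S) * gamma * (eta ^+ 2 / (8 * T))))).
  move: nL; rewrite -SE.
  have -> : 32 * T * (6 * S) / (3 * gamma * eta ^+ 4) * L =
     L / (eta ^+ 2 / (8 * S) * gamma * (eta ^+ 2 / (8 * T))).
    by field; rewrite !gt_eqF.
  by rewrite ler_pdivrMr// !mulr_gt0 ?invr_gt0 ?mulr_gt0// ?exprn_gt0.
rewrite ler_wpM2l// ler_pM//.
  by rewrite mulr_ge0 ?divr_ge0 ?sqr_ge0 ?mulr_ge0 ?(ltW g0) ?(ltW S0).
by rewrite divr_ge0 ?sqr_ge0 ?mulr_ge0 ?(ltW T0).
Qed.

(** * Tail bounds and measurability for the measurement runs *)

(** The data are indexed by all of [nat]; this locality confines the estimate to the finitely many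
    runs of the model. *)
Lemma block_estimator_ext (R : realType) (zd zd' : nat -> R)
    (zo zo' : nat -> R[i]) (n : nat) :
  zd n = zd' n -> (forall j, (j < n)%N -> zo j = zo' j) ->
  block_estimator zd zo n = block_estimator zd' zo' n.
Proof.
move=> zdE zoE.
have pE : phase_estimate zo n = phase_estimate zo' n.
  elim: n zoE {zdE} => //= n IH zoE.
  by rewrite zoE// IH// => j jn; apply: zoE; exact: ltnW.
by case: n zdE zoE pE => // n; rewrite /block_estimator => -> _ ->.
Qed.

Section Runs.
Context {R : realType} {disp : measure_display} {Omega : measurableType disp}.
Context {P : probability Omega R} {T Ndiag Noff : nat}.
Context {D A B : nat -> nat -> {RV P >-> R}} {f : nat -> R[i]}.
Hypothesis model : measurement_model T Ndiag Noff D A B f.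

Let runs := all_runs (T:=T) (Ndiag:=Ndiag) (Noff:=Noff) D A B.

Lemma diag_runs_independent (i : 'I_T) :
  mutually_independent (fun m : 'I_Ndiag => D i m).
Proof.
apply: (mutually_independent_comp P _ _
  (fun m => inl (i, m) : 'I_T * 'I_Ndiag + ('I_T.-1 * 'I_Noff + 'I_T.-1 * 'I_Noff))
  runs); last exact: (independent_runs model).
by move=> m n [].
Qed.

Lemma offdiag_Re_runs_independent (i : 'I_T.-1) :
  mutually_independent (fun m : 'I_Noff => A i m).
Proof.
apply: (mutually_independent_comp P _ _
  (fun m => inr (inl (i, m)) : 'I_T * 'I_Ndiag + ('I_T.-1 * 'I_Noff + 'I_T.-1 * 'I_Noff))
  runs); last exact: (independent_runs model).
by move=> m n [].
Qed.

Lemma offdiag_Im_runs_independent (i : 'I_T.-1) :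
  mutually_independent (fun m : 'I_Noff => B i m).
Proof.
apply: (mutually_independent_comp P _ _
  (fun m => inr (inr (i, m)) : 'I_T * 'I_Ndiag + ('I_T.-1 * 'I_Noff + 'I_T.-1 * 'I_Noff))
  runs); last exact: (independent_runs model).
by move=> m n [].
Qed.

Lemma ltn_predS (i : 'I_T.-1) : (i.+1 < T)%N.
Proof. by rewrite -ltn_predRL. Qed.

(** Diagonal outcomes count as ternary without the value -1, so one finite value set serves the
    whole family. *)
Lemma runs_ternary r w : ternary (runs r w).
Proof.
case: r => [[i m]|[[i m]|[i m]]] /=.
- have [/(_ w)[] -> _] := diag_runs model (ltn_ord i) (ltn_ord m).
    exact: Or33.
  exact: Or31.
- by have [/(_ w)] := offdiag_Re_runs model (ltn_predS i) (ltn_ord m).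
- by have [/(_ w)] := offdiag_Im_runs model (ltn_predS i) (ltn_ord m).
Qed.

Lemma measurable_runs (Q : set Omega) :
  (forall w w', (forall r, runs r w = runs r w') -> Q w -> Q w') -> measurable Q.
Proof.
apply: (measurable_finite_valued P _ _ runs ternary_value) => r w.
exact/ternary_valueP/runs_ternary.
Qed.

Lemma diag_tail (i : 'I_T) (l t : R) : (0 < Ndiag)%N -> 0 <= l <= 1 ->
  modulus (f i) <= 1 ->
  (P [set w | (t <= `|Zdiag Ndiag D w i - modulus (f i) ^+ 2|)%R] <=
   (2 * expR (- (Ndiag%:R * (l * t - 1 * (l ^+ 2 / 2 + l ^+ 3 / 4)))))%:E)%E.
Proof.
move=> N0 l01 f1.
have := sample_mean_tail P Ndiag (D i) (modulus (f i) ^+ 2) 0 l 1 t N0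
  (diag_runs_independent i).
rewrite subr0 addr0; apply => //.
- by move=> m w mN; exact: (runs_ternary (inl (i, Ordinal mN))).
- by move=> m mN; case: (diag_runs model (ltn_ord i) mN).
- move=> m mN; have [D01 _] := diag_runs model (ltn_ord i) mN.
  suff -> : [set w | D i m w = -1] = set0 by rewrite measure0.
  apply/seteqP; split => // w /=; case: (D01 w) => ->; lra.
- by rewrite expr_le1 ?modulus_ge0.
Qed.

(** An outcome has mean c and is nonzero with probability (a + b) / 2 whatever c is, so the same
    bound serves real and imaginary parts. *)
Lemma offdiag_tail (a b c l t : R) (X : nat -> {RV P >-> R}) :
  (0 < Noff)%N -> 0 <= l <= 1 ->
  mutually_independent (fun m : 'I_Noff => X m) ->
  (forall m, (m < Noff)%N -> offdiag_law a b c (X m)) ->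
  (P [set w | (t <= `|sample_mean Noff X w - c|)%R] <=
   (2 * expR (- (Noff%:R * (l * t - (a + b) / 2 * (l ^+ 2 / 2 + l ^+ 3 / 4)))))%:E)%E.
Proof.
move=> N0 l01 indX lawX.
have := sample_mean_tail P Noff X ((a + b + 2 * c) / 4) ((a + b - 2 * c) / 4) l
  ((a + b) / 2) t N0 indX.
have -> : (a + b + 2 * c) / 4 - (a + b - 2 * c) / 4 = c by field.
apply => //.
- by move=> m w mN; have [/(_ w)] := lawX m mN.
- by move=> m mN; case: (lawX m mN).
- by move=> m mN; case: (lawX m mN).
- lra.
Qed.

Lemma Zdiag_itv01 i w : (i < T)%N -> 0 <= Zdiag Ndiag D w i <= 1.
Proof.
move=> iT; rewrite /Zdiag /sample_mean.
have D01 (m : 'I_Ndiag) : 0 <= D i m w <= 1.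
  have [/(_ w)[] -> _] := diag_runs model iT (ltn_ord m).
    by rewrite lexx ler01.
  by rewrite lexx ler01.
have s0 : 0 <= \sum_(m < Ndiag) D i m w.
  by apply: sumr_ge0 => m _; case/andP: (D01 m).
rewrite divr_ge0//=.
(* The mean over no repetition is 0, because the inverse of 0 is 0. *)
have [->|N0] := posnP Ndiag; first by rewrite invr0 mulr0.
rewrite ler_pdivrMr ?ltr0n// mul1r.
rewrite -[X in X%:R]card_ord -sumr_const.
by apply: ler_sum => m _; case/andP: (D01 m).
Qed.

Lemma Zdiag_ext w w' i : (i < T)%N ->
  (forall r, runs r w = runs r w') -> Zdiag Ndiag D w i = Zdiag Ndiag D w' i.
Proof.
move=> iT ww'; rewrite /Zdiag /sample_mean; congr (_ / _).
by apply: eq_bigr => m _; exact: (ww' (inl (Ordinal iT, m))).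
Qed.

Lemma Zoff_ext w w' i : (i < T.-1)%N ->
  (forall r, runs r w = runs r w') -> Zoff Noff A B w i = Zoff Noff A B w' i.
Proof.
move=> iT ww'; rewrite /Zoff /sample_mean; congr (_ / _ +i* (_ / _)).
  by apply: eq_bigr => m _; exact: (ww' (inr (inl (Ordinal iT, m)))).
by apply: eq_bigr => m _; exact: (ww' (inr (inr (Ordinal iT, m)))).
Qed.

Lemma estimator_ext w w' i : (i < T)%N -> (forall r, runs r w = runs r w') ->
  block_estimator (Zdiag Ndiag D w) (Zoff Noff A B w) i =
  block_estimator (Zdiag Ndiag D w') (Zoff Noff A B w') i.
Proof.
move=> iT ww'; apply: block_estimator_ext; first exact: Zdiag_ext.
move=> j ji; apply: Zoff_ext => //.
by rewrite ltn_predRL (leq_ltn_trans ji).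
Qed.

(** As [Ndiag] is positive there is a repetition 0, whose success probability is |f_i|^2. *)
Lemma modulus_le1 i : (0 < Ndiag)%N -> (i < T)%N -> modulus (f i) <= 1.
Proof.
move=> N0 iT; have [_ PD] := diag_runs model iT N0.
rewrite -(@expr_le1 _ 2) ?modulus_ge0// -lee_fin -PD.
by apply: probability_le1; exact: (measurable_funPTI (D i 0%N) (measurable_set1 1)).
Qed.
End Runs.

(** * Error budget and union bound *)

Lemma norm2_le (R : realType) (n : nat) (F : nat -> R[i]) (b : R) : 0 <= b ->
  \sum_(i < n) modulus (F i) ^+ 2 <= b ^+ 2 -> norm2 (\col_(i < n) F i) <= b.
Proof.
move=> b0 Fb; rewrite -(ger0_norm b0) -sqrtr_sqr ler_wsqrtr//.
by under eq_bigr do rewrite mxE.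
Qed.

Lemma min_sqr_modulus_le (R : realType) (T : nat) (f : nat -> R[i]) (i : nat) :
  (i < T)%N -> min_sqr_modulus T f <= modulus (f i) ^+ 2.
Proof. by move=> iT; exact: (@bigmin_le_cond _ _ _ _ (Ordinal iT)). Qed.

Lemma min_sqr_modulus_gt0 (R : realType) (T : nat) (f : nat -> R[i]) :
  (0 < T)%N -> (forall i, (i < T)%N -> f i != 0) -> 0 < min_sqr_modulus T f.
Proof.
by move=> T0 fn0; apply: lt_bigmin => [|i _]; rewrite exprn_gt0// modulus_gt0// fn0.
Qed.

(** Applied with x = 2 T and x = 4 (T - 1), which produce the two logarithms of the theorem. *)
Lemma expR_failure_le (R : realType) (delta x E : R) :
  0 < delta -> 0 < x -> ln (2 * x / delta) <= E ->
  2 * expR (- E) <= delta / x.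
Proof.
move=> d0 x0 LE.
have y0 : 0 < 2 * x / delta by rewrite divr_gt0 ?mulr_gt0.
have : expR (- E) <= (2 * x / delta)^-1.
  by rewrite -[leRHS]lnK ?posrE ?invr_gt0// lnV ?posrE// ler_expR lerN2.
rewrite -(@ler_pM2l _ 2)// => /le_trans; apply.
have -> // : 2 * (2 * x / delta)^-1 = delta / x.
by field; rewrite !gt_eqF.
Qed.

Theorem theorem11 (R : realType) (d : nat) (H : 'M[R[i]]_d)
    (psi : 'cV[R[i]]_d) (Delta : R) (T : nat) (eta delta : R)
    (disp : measure_display) (Omega : measurableType disp)
    (P : probability Omega R) (Ndiag Noff : nat)
    (D A B : nat -> nat -> {RV P >-> R}) :
  let f := signal H psi Delta in
  let gamma := min_sqr_modulus T f in
  (2 <= T)%N ->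
  H \is hermsymmx ->
  norm2 psi = 1 ->
  0 < Delta ->
  (forall i, (i < T)%N -> f i != 0) ->
  0 < eta ->
  0 < delta < 1 ->
  measurement_model T Ndiag Noff D A B f ->
  8 * T%:R / (gamma * eta ^+ 2) * ln (4 * T%:R / delta) <= Ndiag%:R ->
  32 * T%:R * (2 * T%:R ^+ 3 - 3 * T%:R ^+ 2 + T%:R) / (3 * gamma * eta ^+ 4)
    * ln (8 * (T%:R - 1) / delta) <= Noff%:R ->
  ((1 - delta)%:E <=
   P [set w | (norm2 (\col_(i < T)
     (block_estimator (Zdiag Ndiag D w) (Zoff Noff A B w) i - f i)) <= eta)%R])%E.
Proof.
move=> f gamma T2 _ n1 _ fn0 eta0 /andP[d0 d1] model nD nO.
have f0 : f 0%N = 1 by exact: signal0.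
have T0 : (0 < T)%N by exact: leq_trans T2.
set G := [set w | _].
have Gle w : \sum_(i < T) modulus (block_estimator (Zdiag Ndiag D w)
    (Zoff Noff A B w) i - f i) ^+ 2 <= eta ^+ 2 -> G w.
  exact: (norm2_le _ _ (fun i => block_estimator _ _ i - f i) _ (ltW eta0)).
have t2 : 2 <= T%:R :> R by rewrite ler_nat.
have t1 : 0 < T%:R - 1 :> R by lra.
have e22 : 2 * 2 = 4 :> R by ring.
have e24 : 2 * 4 = 8 :> R by ring.
have gle i : (i < T)%N -> gamma <= modulus (f i) ^+ 2 by exact: min_sqr_modulus_le.
have g0 : 0 < gamma by exact: min_sqr_modulus_gt0.
have g1 : gamma <= 1.
  by apply: (le_trans (gle 0%N T0)); rewrite f0 modulus_sqr /= expr1n expr0n addr0.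
(* Both logarithms are positive, which forces at least one repetition of every circuit. *)
have xD : 1 < 4 * T%:R / delta by rewrite ltr_pdivlMr//; lra.
have xO : 1 < 8 * (T%:R - 1) / delta by rewrite ltr_pdivlMr//; lra.
have ND0 : (0 < Ndiag)%N.
  rewrite -(ltr0n R); apply: lt_le_trans nD.
  by rewrite mulr_gt0 ?ln_gt0// divr_gt0 ?mulr_gt0 ?exprn_gt0//; lra.
have NO0 : (0 < Noff)%N.
  rewrite -(ltr0n R); apply: lt_le_trans nO.
  have -> : 2 * T%:R ^+ 3 - 3 * T%:R ^+ 2 + T%:R =
    T%:R * (T%:R - 1) * (2 * T%:R - 1) :> R by ring.
  by rewrite mulr_gt0 ?ln_gt0// divr_gt0 ?mulr_gt0 ?exprn_gt0//; lra.
have f1 i : (i < T)%N -> modulus (f i) <= 1 by exact: (modulus_le1 model).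
have zd01 w i := Zdiag_itv01 model i w.
(* For large [eta] the event is certain, by the crude bound 4 on each entry but the first. *)
have [etaT|etaT] := leP (4 * (T%:R - 1)) (eta ^+ 2).
  suff -> : G = setT by rewrite probability_setT lee_fin; lra.
  apply/seteqP; split=> // w _; apply: Gle.
  apply: le_trans etaT.
  apply: (@le_trans _ _ (\sum_(i < T) 4 * (0 < i)%N%:R)).
    by apply: ler_sum => i _; exact: (estimator_error_le4 T f _ _ f0 fn0 f1 (zd01 w)).
  rewrite -mulr_sumr; case: (T) T0 => // n _.
  by rewrite big_ord_recl /= add0r sumr_const card_ord -[n.+1]addn1 natrD addrK.
have mG : measurable G.
  apply: (measurable_runs model) => w w' ww'.
  suff E : \col_(i < T) (block_estimator (Zdiag Ndiag D w) (Zoff Noff A B w) i - f i) =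
    \col_(i < T) (block_estimator (Zdiag Ndiag D w') (Zoff Noff A B w') i - f i).
    by rewrite /G /= E.
  apply/colP => i; rewrite !mxE; congr (_ - _).
  exact: (estimator_ext w w').
pose S : R := \sum_(i < T) (i ^ 2)%:R.
have SE : 6 * S = 2 * T%:R ^+ 3 - 3 * T%:R ^+ 2 + T%:R := sum_sqr_ord R T.
(* Needed for v = 2 tau^2 = eta^2 / (4 S) < (T - 1) / S <= 1. *)
have S1 : T%:R - 1 <= S.
  rewrite -(@ler_pM2l _ 6)// SE -subr_ge0.
  have -> : 2 * T%:R ^+ 3 - 3 * T%:R ^+ 2 + T%:R - 6 * (T%:R - 1) =
    (T%:R - 1) * (T%:R - 2) * (2 * T%:R + 3) :> R by ring.
  by rewrite !mulr_ge0//; lra.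
have S0 : 0 < S by lra.
(* The deviations are chosen so that T eps^2 / gamma and 4 tau^2 S both equal eta^2 / 2. *)
pose eps := Num.sqrt (gamma * eta ^+ 2 / (2 * T%:R)).
have epsE : eps ^+ 2 = gamma * eta ^+ 2 / (2 * T%:R).
  by rewrite sqr_sqrtr// divr_ge0 ?mulr_ge0 ?sqr_ge0// ltW.
pose tau := Num.sqrt (eta ^+ 2 / (8 * S)).
have tauE : tau ^+ 2 = eta ^+ 2 / (8 * S).
  by rewrite sqr_sqrtr// divr_ge0 ?sqr_ge0// mulr_ge0// ltW.
pose ReZ i := complex.Re (f i * (f i.+1)^*).
pose ImZ i := complex.Im (f i * (f i.+1)^*).
pose Z i := modulus (f i * (f i.+1)^*).
pose F (k : 'I_T + ('I_T.-1 + 'I_T.-1)) : set Omega :=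
  match k with
  | inl i => [set w | (eps <= `|Zdiag Ndiag D w i - modulus (f i) ^+ 2|)%R]
  | inr (inl i) => [set w | (tau * Z i <= `|sample_mean Noff (A i) w - ReZ i|)%R]
  | inr (inr i) => [set w | (tau * Z i <= `|sample_mean Noff (B i) w - ImZ i|)%R]
  end.
have mF k : measurable (F k).
  apply: (measurable_runs model) => w w' ww'.
  case: k => [i|[i|i]]; rewrite /F /=.
  - by rewrite (Zdiag_ext w w' _ (ltn_ord i) ww').
  - have /(congr1 (@complex.Re R)) /= -> // :=
      Zoff_ext w w' _ (ltn_ord i) ww'.
  - have /(congr1 (@complex.Im R)) /= -> // :=
      Zoff_ext w w' _ (ltn_ord i) ww'.
have PFdiag (i : 'I_T) : (P (F (inl i)) <= (delta / (2 * T%:R))%:E)%E.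
  have [l01 le] := diag_sample_size _ _ _ _ _ _ _ t2
    (introT andP (conj g0 g1)) eta0 etaT (sqrtr_ge0 _) epsE (ler0n _ _) nD.
  apply: (le_trans (diag_tail model i _ eps ND0 l01 (f1 _ (ltn_ord i)))).
  rewrite lee_fin.
  apply: (expR_failure_le _ delta (2 * T%:R) _ d0); first by rewrite mulr_gt0// ltr0n.
  by rewrite mulrA e22.
have offE (i : 'I_T.-1) (c : R) (X : nat -> {RV P >-> R}) :
    mutually_independent (fun m : 'I_Noff => X m) ->
    (forall m, (m < Noff)%N ->
      offdiag_law (modulus (f i) ^+ 2) (modulus (f i.+1) ^+ 2) c (X m)) ->
    (P [set w | (tau * Z i <= `|sample_mean Noff X w - c|)%R] <=
      (delta / (4 * (T%:R - 1)))%:E)%E.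
  move=> indX lawX.
  have iT := ltn_predS i.
  have Z0 : 0 < Z i.
    by rewrite modulus_gt0// mulf_neq0 ?fmorph_eq0 ?fn0// ltnW.
  have ZE : Z i ^+ 2 = modulus (f i) ^+ 2 * modulus (f i.+1) ^+ 2.
    by rewrite /Z modulusM modulus_conj exprMn.
  have [l01 le] := offdiag_sample_size _ _ _ _ _ _ _ _ _ _ _ t2 SE g0
    (gle _ (ltnW iT)) (gle _ iT) Z0 ZE eta0 etaT (sqrtr_ge0 _) tauE (ler0n _ _) nO.
  apply: (le_trans (offdiag_tail _ _ _ _ _ X NO0 l01 indX lawX)).
  rewrite lee_fin.
  apply: (expR_failure_le _ delta (4 * (T%:R - 1)) _ d0); first by rewrite mulr_gt0.
  by rewrite mulrA e24.
have GF : ~` G `<=` \bigcup_k F k.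
  move=> w Gw; apply: contrapT => Fw; apply: Gw.
  have nF k : ~ F k w by move=> Fk; apply: Fw; exists k.
  have v01 : 0 <= 2 * tau ^+ 2 < 1.
    rewrite mulr_ge0 ?sqr_ge0//= tauE mulrA ltr_pdivrMr; last by lra.
    lra.
  apply: Gle.
  apply: (@le_trans _ _ (\sum_(i < T)
      (eps ^+ 2 / gamma + 2 * (2 * tau ^+ 2) * (i ^ 2)%:R))).
    apply: ler_sum => i _.
    apply: (estimator_error T f _ _ f0 fn0 f1 (zd01 w) _ _ v01) => // j jT.
      have /negP := nF (inl (Ordinal jT)); rewrite -ltNge /= => /ltW h.
      (* The absolute error eps becomes the relative one e = eps^2 / gamma because |f_j|^2 >=
         gamma. *)
      apply: (@le_trans _ _ (eps ^+ 2)).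
        by rewrite -[leLHS]real_normK ?num_real// lerXn2r ?nnegrE ?sqrtr_ge0.
      by rewrite mulrAC ler_pdivlMr// ler_wpM2l ?sqr_ge0// gle.
    have jT' : (j < T.-1)%N by rewrite ltn_predRL.
    have hsq (x y : R) : 0 <= y -> `|x| < y -> x ^+ 2 <= y ^+ 2.
      by move=> y0 /ltW xy; rewrite -[leLHS]real_normK ?num_real// lerXn2r ?nnegrE.
    have tZ0 : 0 <= tau * Z j by rewrite mulr_ge0 ?sqrtr_ge0 ?modulus_ge0.
    have /negP := nF (inr (inl (Ordinal jT'))); rewrite -ltNge /= => /(hsq _ _ tZ0) hR.
    have /negP := nF (inr (inr (Ordinal jT'))); rewrite -ltNge /= => /(hsq _ _ tZ0) hI.
    (* The real and imaginary parts each contribute tau^2 |Z|^2, whence v = 2 tau^2. *)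
    rewrite modulus_sqr raddfB (raddfB (@complex.Im R)) /=.
    move: hR hI; rewrite /ReZ /ImZ exprMn -/(Z j); lra.
  rewrite big_split/= sumr_const card_ord -mulr_sumr -/S epsE tauE.
  rewrite -[_ *+ T]mulr_natr le_eqVlt; apply/predU1P; left; field.
  by rewrite (gt_eqF S0) (gt_eqF g0) pnatr_eq0 -lt0n T0.
have PG : (P (~` G) <= delta%:E)%E.
  apply: (le_trans (measure_le_sum_cover _ _ _ P _ _ F (measurableC mG) mF GF)).
  rewrite big_sumType /= big_sumType /=.
  (* The diagonal events cost delta / 2 in total, the real and the imaginary ones delta / 4 each. *)
  apply: (@le_trans _ _ ((\sum_(i < T) delta / (2 * T%:R))%:E +
    ((\sum_(i < T.-1) delta / (4 * (T%:R - 1)))%:E +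
     (\sum_(i < T.-1) delta / (4 * (T%:R - 1)))%:E))%E).
    rewrite -!sumEFin; apply: leeD; first by apply: lee_sum => i _; exact: PFdiag.
    apply: leeD; apply: lee_sum => i _; apply: offE.
    - exact: (offdiag_Re_runs_independent model).
    - by move=> m mN; exact: (offdiag_Re_runs model (ltn_predS i) mN).
    - exact: (offdiag_Im_runs_independent model).
    - by move=> m mN; exact: (offdiag_Im_runs model (ltn_predS i) mN).
  rewrite -!EFinD lee_fin !sumr_const !card_ord.
  rewrite -[_ *+ T]mulr_natr -[_ *+ T.-1]mulr_natr.
  have -> : (T.-1)%:R = T%:R - 1 :> R by rewrite -subn1 natrB.
  rewrite le_eqVlt; apply/predU1P; left; field.
  by rewrite (gt_eqF t1) pnatr_eq0 -lt0n T0.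
have -> : P G = (1 - P (~` G))%E by rewrite -probability_setC ?setCK//; exact: measurableC.
by rewrite EFinB leeB.
Qed.
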